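(* For all $n,\ell,r\ge 2$, \(\alpha\bigl(J^{(r)}_{n,\ell}\bigr)=\binom nr-t_r(n,\ell-1)\).
   Context: Let $\mathbf{k}$ be a field of characteristic zero and $R_{n,r}=\mathbf{k}[y_E:E\in\binom{[n]}r]$. For a pair $\{a,b\}\subset[n]$, $u^{(r)}_{ab}=\prod_{E\in\binom{[n]}r,\ \{a,b\}\subset E}y_E$, and $J^{(r)}_{n,\ell}=\bigcap_{L\in\binom{[n]}{\ell}}(u^{(r)}_{ab}:\{a,b\}\subset L)\subset R_{n,r}$. $\alpha(\cdot)$ denotes the initial degree of a homogeneous ideal. $t_r(n,q)$ is the number of edges of the complete balanced $q$-partite $r$-graph on $n$ vertices, i.e. $\sum_{S\in\binom{[q]}r}\prod_{i\in S}n_i$ for balanced class sizes $n_1,\ldots,n_q$ (zero if $r>q$). *)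

(* Defs.v *)
From mathcomp Require Import all_boot all_order all_algebra.
From mathcomp Require Import mpoly.

Set Implicit Arguments.
Unset Strict Implicit.
Unset Printing Implicit Defensive.

Import GRing.Theory.
Local Open Scope ring_scope.

(* [n] is rendered as 'I_n, so that edge n r is the set of r-subsets of [n]. *)
Definition edge (n r : nat) : finType := {E : {set 'I_n} | #|E| == r}.

Notation edge_ring k n r := {mpoly k[#|edge n r|]}.

Definition y (k : fieldType) (n r : nat) (E : edge n r) : edge_ring k n r :=
  'X_(enum_rank E).

(* The pair {a, b} is given as the set P. *)
Definition u (k : fieldType) (n r : nat) (P : {set 'I_n}) : edge_ring k n r :=
  \prod_(E : edge n r | P \subset sval E) y k E.

Definition in_ideal (R : comNzRingType) (I : finType) (A : pred I)
    (g : I -> R) (p : R) : Prop :=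
  exists c : I -> R, p = \sum_(i | A i) c i * g i.

Definition J (k : fieldType) (n l r : nat) (p : edge_ring k n r) : Prop :=
  forall L : {set 'I_n}, #|L| = l ->
    in_ideal (fun P : {set 'I_n} => (#|P| == 2%N) && (P \subset L)) (u k r) p.

(* The initial degree of a homogeneous ideal I is the least d such that the
   graded piece I_d is nonzero; it is stated as a relation because it is
   undefined for the zero ideal. Note that 0 is d.-homog for every d. *)
Definition initial_degree (k : fieldType) (m : nat) (I : {mpoly k[m]} -> Prop)
    (d : nat) : Prop :=
  (exists p, [/\ I p, p != 0 & p \is d.-homog]) /\
  (forall e p, I p -> p != 0 -> p \is e.-homog -> (d <= e)%N).

Lemma initial_degree_uniq (k : fieldType) (m : nat) (I : {mpoly k[m]} -> Prop)
    (d e : nat) : initial_degree I d -> initial_degree I e -> d = e.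
Proof.
move=> [[p [Ip p0 hp]] mind] [[q [Iq q0 hq]] mine]; apply/eqP.
by rewrite eqn_leq (mind _ q) // (mine _ p).
Qed.

Definition class_size (n q i : nat) : nat := (n %/ q + (i < n %% q))%N.

Lemma sum_class_size (n q : nat) :
  (0 < q)%N -> (\sum_(i < q) class_size n q i = n)%N.
Proof.
move=> q0; rewrite big_split /= sum_nat_const card_ord.
rewrite -(big_mkord xpredT (fun i => nat_of_bool (i < n %% q)%N)).
rewrite (big_cat_nat (n := (n %% q)%N)) ?leq0n ?(ltnW (ltn_pmod n q0)) //=.
have -> : (\sum_(0 <= i < n %% q) (i < n %% q) = n %% q)%N.
  rewrite big_nat (eq_bigr (fun=> 1%N)) => [|i /andP[_ ->]//].
  by rewrite -big_nat sum_nat_const_nat subn0 muln1.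
rewrite big_nat big1 => [|i /andP[h _]]; last by rewrite ltnNge h.
by rewrite addn0 mulnC -divn_eq.
Qed.

Definition turan (r n q : nat) : nat :=
  (\sum_(S : {set 'I_q} | #|S| == r) \prod_(i in S) class_size n q i)%N.

(* Main.v *)
(* J is a monomial ideal.  A monomial m lies in J iff every l-subset of [n]
   contains a pair {a, b} such that y_E divides m for all edges E containing
   {a, b}; that is, iff the edges not dividing m form an r-graph whose shadow
   has no clique on l vertices.  By Zykov's theorem such an r-graph has at most
   t_r(n, l-1) edges, which bounds deg m from below.  Equality is attained by
   the product of the y_E over the edges E that are not rainbow when [n] is
   colored by residues modulo l-1.  Zykov's theorem follows by induction on the
   clique number from Erdős's degree argument, once the elementary symmetric
   functions of q natural numbers with given sum are known to be largest when
   these numbers are balanced. *)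

Require Import Defs.
From mathcomp Require Import all_boot all_order all_algebra zify.
From mathcomp Require Import mpoly.

Set Implicit Arguments.
Unset Strict Implicit.
Unset Printing Implicit Defensive.

Import GRing.Theory.
Local Open Scope ring_scope.

Section ElementarySymmetric.

Variable R : comNzSemiRingType.
Implicit Types (r : nat) (x : R) (s t : seq R).

Definition elem_sym r s : R := (\prod_(x <- s) (1 + x%:P * 'X))`_r.

Lemma elem_sym_nil r : elem_sym r [::] = (r == 0%N)%:R.
Proof. by rewrite /elem_sym big_nil coef1. Qed.

Lemma elem_sym_consS r x s :
  elem_sym r.+1 (x :: s) = elem_sym r.+1 s + x * elem_sym r s.
Proof.
by rewrite /elem_sym big_cons mulrDl mul1r coefD -mulrA coefCM coefXM.
Qed.

Lemma elem_sym0 s : elem_sym 0 s = 1.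
Proof.
rewrite /elem_sym coef0_prod big1 // => x _.
by rewrite coefD coef1 coefMX addr0.
Qed.

Lemma perm_elem_sym r s t : perm_eq s t -> elem_sym r s = elem_sym r t.
Proof. by move=> st; rewrite /elem_sym (perm_big _ st). Qed.

Lemma elem_sym_codom (I : finType) (f : I -> R) r :
  elem_sym r (codom f) = \sum_(S : {set I} | #|S| == r) \prod_(i in S) f i.
Proof.
rewrite /elem_sym codomE big_map big_enum /=.
under eq_bigr do rewrite addrC.
rewrite bigA_distr coef_sum [RHS]big_mkcond; apply: eq_bigr => S _.
rewrite -big_mkcond big_split /= prodr_const -rmorph_prod coefCM coefXn eq_sym.
by case: eqP; rewrite ?mulr1 ?mulr0.
Qed.

End ElementarySymmetric.

Local Open Scope nat_scope.

Definition class_sizes (n q : nat) : seq nat :=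
  codom (fun i : 'I_q => class_size n q i).

Lemma turanE r n q : turan r n q = elem_sym r (class_sizes n q).
Proof. by rewrite elem_sym_codom. Qed.

Lemma size_class_sizes n q : size (class_sizes n q) = q.
Proof. by rewrite size_codom card_ord. Qed.

Lemma sumn_class_sizes n q : 0 < q -> sumn (class_sizes n q) = n.
Proof. by move=> q0; rewrite sumnE big_image sum_class_size. Qed.

Definition nearly_constant (m : nat) (s : seq nat) : bool :=
  all (fun x => m <= x <= m.+1) s.

Lemma nearly_constant_sumn m s :
  nearly_constant m s -> m * size s <= sumn s <= m.+1 * size s.
Proof.
by elim: s => [|x s ih] /=; [rewrite !muln0 | case/andP=> mx /ih; nia].
Qed.

Lemma nearly_constant_perm_nseq m s : nearly_constant m s ->
  perm_eq s
    (nseq (sumn s - m * size s) m.+1 ++ nseq (m.+1 * size s - sumn s) m).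
Proof.
elim: s => [|x s ih] /=; first by rewrite !muln0.
case/andP=> mx ms; have /andP[sge sle] := nearly_constant_sumn ms.
have [->|xm] := eqVneq x m.
  have -> : m + sumn s - m * (size s).+1 = sumn s - m * size s by nia.
  have -> : m.+1 * (size s).+1 - (m + sumn s) = (m.+1 * size s - sumn s).+1.
    by nia.
  by rewrite perm_sym (perm_catCA _ [:: m]) perm_cons perm_sym ih.
have -> : x = m.+1 by lia.
have -> : m.+1 + sumn s - m * (size s).+1 = (sumn s - m * size s).+1 by nia.
have -> : m.+1 * (size s).+1 - (m.+1 + sumn s) = m.+1 * size s - sumn s by nia.
by rewrite /= perm_cons ih.
Qed.

Lemma nearly_constant_perm m s t : nearly_constant m s -> nearly_constant m t ->
  size s = size t -> sumn s = sumn t -> perm_eq s t.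
Proof.
move=> /nearly_constant_perm_nseq ms /nearly_constant_perm_nseq mt.
by move=> st_size st_sumn; rewrite (permPl ms) st_size st_sumn perm_sym.
Qed.

Lemma nearly_constant_class_sizes m n q :
  m * q <= n <= m.+1 * q -> nearly_constant m (class_sizes n q).
Proof.
move=> n_bounds; apply/allP => _ /codomP[i ->]; rewrite /class_size.
have q0 := leq_ltn_trans (leq0n i) (ltn_ord i).
have := divn_eq n q; have := ltn_pmod n q0.
by case: ltnP; nia.
Qed.

Lemma nearly_constant_perm_class_sizes m s :
  nearly_constant m s -> perm_eq s (class_sizes (sumn s) (size s)).
Proof.
have [/size0nil ->|s0] := posnP (size s).
  by rewrite /class_sizes codomE enum_ord0.
move=> ms; apply: (nearly_constant_perm ms).
- exact/nearly_constant_class_sizes/nearly_constant_sumn.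
- by rewrite size_class_sizes.
- by rewrite sumn_class_sizes.
Qed.

Lemma nearly_constant_or_gap (s : seq nat) : (exists m, nearly_constant m s) \/
  exists x z t, z < x /\ perm_eq s [:: x.+1, z & t].
Proof.
have [/size0nil ->|] := posnP (size s); first by left; exists 0.
case: s => // x0 s0 _; set s := x0 :: s0.
have /ex_minnP[m ms m_min] : exists m, m \in s by exists x0; rewrite mem_head.
have [|/allPn[x xs x_far]] := boolP (nearly_constant m s).
  by left; exists m.
right.
have mx : m.+1 < x by move: (m_min _ xs) x_far; lia.
have m_rem : m \in rem x s.
  move: ms; rewrite (perm_mem (perm_to_rem xs)) inE.
  by case: eqP => [|_ //]; lia.
exists x.-1, m, (rem m (rem x s)); split; first by lia.
rewrite prednK ?(leq_trans _ mx) //; apply: perm_trans (perm_to_rem xs) _.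
by rewrite perm_cons perm_to_rem.
Qed.

Lemma smoothing_le_class_sizes (f : seq nat -> nat) :
    (forall s t, perm_eq s t -> f s = f t) ->
    (forall x z s, z < x -> f [:: x.+1, z & s] <= f [:: x, z.+1 & s]) ->
  forall s, f s <= f (class_sizes (sumn s) (size s)).
Proof.
(* The sum of squares strictly decreases along unit transfers. *)
move=> f_perm f_transfer s; have [N] := ubnP (sumn [seq x ^ 2 | x <- s]).
elim: N s => // N ih s squares_lt.
have [[m ms]|[x [z [t [zx st]]]]] := nearly_constant_or_gap s.
  by rewrite (f_perm _ _ (nearly_constant_perm_class_sizes ms)).
rewrite (f_perm _ _ st) (perm_sumn st) (perm_size st).
apply: leq_trans (f_transfer _ _ _ zx) _.
have := ih [:: x, z.+1 & t]; rewrite /= addSn addnS; apply.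
have := perm_sumn (perm_map (fun x => x ^ 2) st).
by move: squares_lt; rewrite /= -!mulnn; nia.
Qed.

Lemma elem_sym_transfer r x z s : z < x ->
  elem_sym r [:: x.+1, z & s] <= elem_sym r [:: x, z.+1 & s].
Proof.
move=> zx; case: r => [|[|r]]; first by rewrite !elem_sym0.
  by rewrite !elem_sym_consS !elem_sym0; lia.
rewrite !elem_sym_consS; nia.
Qed.

Lemma elem_sym_le_turan r s : elem_sym r s <= turan r (sumn s) (size s).
Proof.
rewrite turanE.
apply: (smoothing_le_class_sizes (f := elem_sym r)) => [t u|x z t].
  exact: perm_elem_sym.
exact: elem_sym_transfer.
Qed.

Lemma turan0 n q : turan 0 n q = 1.
Proof. by rewrite turanE elem_sym0. Qed.

Lemma turan_add_class r n m q :
  turan r.+1 n q + m * turan r n q <= turan r.+1 (n + m) q.+1.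
Proof.
case: q => [|q].
  have := elem_sym_le_turan r.+1 [:: n + m]; rewrite /= addn0; apply: leq_trans.
  rewrite elem_sym_consS !turanE /class_sizes !codomE enum_ord0.
  by rewrite leq_add2l leq_mul2r leq_addl orbT.
have := elem_sym_le_turan r.+1 (m :: class_sizes n q.+1).
rewrite elem_sym_consS -!turanE /= size_class_sizes sumn_class_sizes //.
by rewrite addnC.
Qed.

Lemma leq_card_bigcup (I T : finType) (P : pred I) (F : I -> {set T}) :
  #|\bigcup_(i | P i) F i| <= \sum_(i | P i) #|F i|.
Proof.
elim/big_ind2: _ => [|A a B b Aa Bb|//]; first by rewrite cards0.
exact: leq_trans (leq_card_setU _ _) (leq_add Aa Bb).
Qed.

Section Cliques.

Variables (T : finType) (e : rel T).
Implicit Types (A B N V : {set T}) (v : T).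

Definition clique A : bool :=
  [forall x in A, forall z in A, (x != z) ==> e x z].

Definition cliques (r : nat) V : {set {set T}} :=
  [set A : {set T} | [&& A \subset V, #|A| == r & clique A]].

Definition clique_number V : nat :=
  \max_(A : {set T} | (A \subset V) && clique A) #|A|.

Definition neighbors V v : {set T} := [set x in V :\ v | e v x].

Lemma cliqueP A : reflect {in A &, forall x z, x != z -> e x z} (clique A).
Proof.
apply: (iffP forall_inP) => [clA x z xA zA|clA x xA].
  by move/forall_inP/(_ z zA)/implyP: (clA x xA); apply.
by apply/forall_inP => z zA; apply/implyP; apply: clA.
Qed.

Lemma clique0 : clique set0.
Proof. by apply/cliqueP => x; rewrite inE. Qed.

Lemma cliqueS A B : A \subset B -> clique B -> clique A.
Proof.
by move=> /subsetP AB /cliqueP clB; apply/cliqueP => x z /AB + /AB; apply: clB.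
Qed.

Lemma cliqueU1 v A :
  ssrbool.symmetric e -> {in A, forall x, e v x} -> clique A -> clique (v |: A).
Proof.
move=> e_sym vA /cliqueP clA; apply/cliqueP => x z.
rewrite !inE => /predU1P[->|xA] /predU1P[->|zA]; rewrite ?eqxx // => xz.
- exact: vA.
- by rewrite e_sym vA.
- exact: clA.
Qed.

Lemma card_clique_le A V : A \subset V -> clique A -> #|A| <= clique_number V.
Proof. by move=> AV clA; apply: leq_bigmax_cond; rewrite AV. Qed.

Lemma neighbors_sub V v : neighbors V v \subset V.
Proof. by apply/subsetP => x; rewrite !inE => /andP[/andP[]]. Qed.

Lemma clique_number_neighbors V v : ssrbool.symmetric e -> v \in V ->
  clique_number (neighbors V v) < clique_number V.
Proof.
move=> e_sym vV; rewrite /clique_number.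
have [|A] := @eq_bigmax_cond _
  [pred A : {set T} | (A \subset neighbors V v) && clique A]
  (fun A : {set T} => #|A|).
  by apply/card_gt0P; exists set0; rewrite inE sub0set clique0.
rewrite inE => /andP[/subsetP AN clA] ->.
have -> : #|A|.+1 = #|v |: A|.
  by rewrite cardsU1; case: (boolP (v \in A)) => // /AN; rewrite !inE eqxx.
apply: card_clique_le.
  rewrite subUset sub1set vV; apply/subsetP => x /AN.
  exact/(subsetP (neighbors_sub V v)).
by apply: cliqueU1 => // x /AN; rewrite inE => /andP[].
Qed.

Lemma card_cliques0 V : #|cliques 0 V| = 1.
Proof.
rewrite -(cards1 (@set0 T)); congr #|pred_of_set _|; apply/setP => A.
rewrite !inE cards_eq0.
by have [->|] := eqVneq A set0; rewrite ?sub0set ?clique0 ?andbF.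
Qed.

Lemma cliques_eq0 r V : clique_number V < r -> cliques r V = set0.
Proof.
move=> Vr; apply/setP => A; rewrite !inE; apply: contraTF Vr.
by case/and3P=> AV /eqP <- clA; rewrite -leqNgt card_clique_le.
Qed.

Lemma card_cliques_through_le r V v :
  #|[set A in cliques r.+1 V | v \in A]| <= #|cliques r (neighbors V v)|.
Proof.
rewrite -(card_in_imset (f := fun A => A :\ v)) => [|A B]; last first.
  rewrite !inE => /andP[_ vA] /andP[_ vB] /= AB.
  by rewrite -(setD1K vA) AB setD1K.
apply/subset_leq_card/subsetP => _ /imsetP[A + ->]; rewrite !inE.
case/andP=> /and3P[AV /eqP Ar clA] vA.
rewrite (cliqueS (subD1set A v) clA) andbT; apply/andP; split; last first.
  by move/eqP: (cardsD1 v A); rewrite vA Ar eqSS eq_sym.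
apply/subsetP => x; rewrite !inE => /andP[xv xA].
by rewrite xv (subsetP AV) //= (cliqueP _ clA) // eq_sym.
Qed.

Lemma card_cliques_le_split r d V N :
    {in V :\: N, forall w, #|[set A in cliques r V | w \in A]| <= d} ->
  #|cliques r V| <= #|cliques r N| + d * #|V :\: N|.
Proof.
move=> deg_le; pose through w := [set A in cliques r V | w \in A].
have cover :
    cliques r V \subset cliques r N :|: \bigcup_(w in V :\: N) through w.
  apply/subsetP => A A_clique; rewrite in_setU.
  move: (A_clique); rewrite !inE => /and3P[/subsetP AV -> ->].
  have [//|/subsetPn[w wA wN]] := boolP (A \subset N).
  by apply/bigcupP; exists w; rewrite inE ?wN ?AV // A_clique.
apply: leq_trans (subset_leq_card cover) _.
apply: leq_trans (leq_card_setU _ _) _; rewrite leq_add2l mulnC -sum_nat_const.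
apply: leq_trans (leq_card_bigcup _ _) _.
exact: leq_sum.
Qed.

Lemma card_cliques_le_turan r q V : ssrbool.symmetric e ->
  clique_number V <= q -> #|cliques r V| <= turan r #|V| q.
Proof.
move=> e_sym; elim: q r V => [|q ih] [|r] V Vq.
all: rewrite ?card_cliques0 ?turan0 //.
  by rewrite cliques_eq0 ?cards0 // (leq_ltn_trans Vq).
have [->|[A]] := set_0Vmem (cliques r.+1 V); first by rewrite cards0.
rewrite inE => /and3P[/subsetP AV /eqP Ar _].
have /card_gt0P[v0 /AV v0V] : 0 < #|A| by rewrite Ar.
(* A vertex v of largest degree: every clique not contained in its neighborhood
   passes through one of its non-neighbors, which has no larger degree. *)
pose deg v := #|[set A in cliques r.+1 V | v \in A]|.
case: (arg_maxnP deg v0V) => v vV deg_max; set N := neighbors V v.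
have Nq : clique_number N <= q.
  by rewrite -ltnS (leq_trans (clique_number_neighbors e_sym vV)).
have deg_le : {in V :\: N, forall w, deg w <= turan r #|N| q}.
  move=> w /setDP[wV _]; apply: leq_trans (deg_max w wV) _.
  exact: leq_trans (card_cliques_through_le _ _ _) (ih _ _ Nq).
apply: leq_trans (card_cliques_le_split deg_le) _.
have -> : #|V| = #|N| + #|V :\: N|.
  by rewrite -(cardsID N V) (setIidPr (neighbors_sub V v)).
apply: leq_trans (turan_add_class _ _ _ _); rewrite mulnC leq_add2r.
exact: ih.
Qed.

End Cliques.

Definition shadow (T : finType) (G : {set {set T}}) : rel T :=
  fun a b => [exists E in G, [set a; b] \subset E].

Lemma shadow_sym (T : finType) (G : {set {set T}}) :
  ssrbool.symmetric (shadow G).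
Proof. by move=> a b; rewrite /shadow setUC. Qed.

Lemma card_uniform_le_turan (T : finType) (G : {set {set T}}) (r q : nat) :
    {in G, forall E : {set T}, #|E| = r} ->
    clique_number (shadow G) setT <= q ->
  #|G| <= turan r #|T| q.
Proof.
move=> Gr Gq; rewrite -cardsT.
apply: leq_trans (card_cliques_le_turan r (@shadow_sym _ G) Gq).
apply/subset_leq_card/subsetP => E EG; rewrite inE subsetT (Gr E EG) eqxx /=.
apply/cliqueP => a b aE bE _; apply/exists_inP; exists E => //.
by rewrite subUset !sub1set aE.
Qed.

Section Rainbow.

Variables (I T : finType) (c : T -> I).
Implicit Types (A : {set T}) (S : {set I}).

Definition rainbow A : bool := #|c @: A| == #|A|.

(* A rainbow set onto S meets each fiber over S in a singleton and is empty
   elsewhere, so its slices range over a pfamily with default value set0. *)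
Definition slices A : {ffun I -> {set T}} := [ffun i => A :&: c @^-1: [set i]].

Definition slice_choices S :=
  pfamily set0 (mem S) (fun i => [set [set x] | x in c @^-1: [set i]]).

Lemma slices_inj : injective slices.
Proof.
move=> A B AB; apply/setP => x.
have /setP/(_ x) := congr1 (fun f : {ffun _} => f (c x)) AB.
by rewrite !ffunE !inE eqxx !andbT.
Qed.

Lemma rainbow_slices A : rainbow A -> slices A \in slice_choices (c @: A).
Proof.
move=> /imset_injP c_inj; apply/pfamilyP; split=> [|_ /imsetP[x xA ->]].
  apply/subsetP => i; rewrite inE ffunE => /set0Pn[x].
  by rewrite !inE => /andP[xA /eqP <-]; apply: imset_f.
apply/imsetP; exists x; rewrite ?inE // ffunE; apply/setP => z; rewrite !inE.
by apply/andP/eqP => [[zA /eqP/c_inj ->]|->].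
Qed.

Lemma slice_choices_rainbow S f : f \in slice_choices S ->
  exists2 A, f = slices A & rainbow A && (c @: A == S).
Proof.
case/pfamilyP=> /subsetP supp fS; pose A := \bigcup_i f i.
have supp_of i x : x \in f i -> i \in S.
  by move=> xfi; apply: supp; apply/set0Pn; exists x.
have f_sub i x : x \in f i -> c x = i.
  move=> xfi; have /imsetP[z] := fS i (supp_of i x xfi).
  by rewrite !inE => /eqP cz fi; move: xfi; rewrite fi inE => /eqP ->.
have AE x : (x \in A) = (x \in f (c x)).
  apply/bigcupP/idP => [[i _ xfi]|xf]; last by exists (c x).
  by rewrite (f_sub i x).
exists A; last (apply/andP; split).
- apply/ffunP => i; rewrite ffunE; apply/setP => x; rewrite !inE AE.
  by apply/idP/andP => [xfi|[xf /eqP <-//]]; rewrite (f_sub i).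
- apply/imset_injP => x z; rewrite !AE => xf zf cxz; move: xf zf; rewrite -cxz.
  move=> xf; have /imsetP[w _ fw] := fS _ (supp_of _ _ xf); move: xf.
  by rewrite fw !inE => /eqP -> /eqP.
apply/eqP/setP => i; apply/imsetP/idP => [[x + ->]|iS].
  by rewrite AE; apply: supp_of.
have /imsetP[x] := fS i iS; rewrite !inE => /eqP cx fi; exists x => //.
by rewrite AE cx fi inE.
Qed.

Lemma card_slice_choices S :
  #|slice_choices S| = \prod_(i in S) #|c @^-1: [set i]|.
Proof.
under [RHS]eq_bigr do rewrite -(card_imset _ (@set1_inj T)) -sum1_card.
rewrite (big_distr_big_dep set0) /= -sum1_card.
by apply: eq_bigr => f _; rewrite big1.
Qed.

Lemma card_rainbow_onto S :
  #|[set A | rainbow A && (c @: A == S)]| = \prod_(i in S) #|c @^-1: [set i]|.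
Proof.
rewrite -card_slice_choices -(card_imset _ slices_inj); apply: eq_card => f.
apply/imsetP/idP => [[A + ->]|/slice_choices_rainbow[A -> AS]]; last first.
  by exists A; rewrite ?inE.
by rewrite inE => /andP[Ar /eqP <-]; apply: rainbow_slices.
Qed.

Lemma card_rainbow r : #|[set A : {set T} | (#|A| == r) && rainbow A]| =
  \sum_(S : {set I} | #|S| == r) \prod_(i in S) #|c @^-1: [set i]|.
Proof.
rewrite -sum1_card (partition_big (fun A : {set T} => c @: A)
  (fun S : {set I} => #|S| == r)) => [|A].
  apply: eq_bigr => S /eqP Sr; rewrite -card_rainbow_onto sum1dep_card.
  apply: eq_card => A; rewrite !inE -andbA andb_idl //.
  by move=> /andP[/eqP + /eqP cAS]; rewrite cAS Sr => ->.
by rewrite inE => /andP[/eqP <-].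
Qed.

End Rainbow.

Lemma card_residue_class (n q i : nat) :
  i < q -> #|[set x : 'I_n | x %% q == i]| = class_size n q i.
Proof.
move=> iq; have q0 : 0 < q by apply: leq_ltn_trans iq.
rewrite -sum1dep_card big_mkcond /=.
elim: n => [|n ih]; first by rewrite big_ord0 /class_size div0n mod0n.
rewrite big_ord_recr /= ih /class_size.
have := divn_eq n q; have := divn_eq n.+1 q.
have := ltn_pmod n q0; have := ltn_pmod n.+1 q0.
case: ltnP; case: ltnP; case: eqP; nia.
Qed.

Definition residue (n q : nat) (x : 'I_n) : 'I_q.+1 := inZp x.

Lemma card_rainbow_residue n q r :
  #|[set A : {set 'I_n} | (#|A| == r) && rainbow (residue q) A]| =
    turan r n q.+1.
Proof.
rewrite card_rainbow; apply: eq_bigr => S _; apply: eq_bigr => i _.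
by rewrite -card_residue_class //; apply: eq_card => x; rewrite !inE.
Qed.

Lemma card_edge_pred n r (P : pred {set 'I_n}) :
  #|[set E : edge n r | P (val E)]| =
    #|[set A : {set 'I_n} | (#|A| == r) && P A]|.
Proof.
rewrite -(card_imset _ val_inj); apply: eq_card => A; rewrite inE.
apply/imsetP/andP => [[E + ->]|[Ar PA]]; first by rewrite inE (valP E).
by exists (exist _ A Ar : edge n r); rewrite ?inE.
Qed.

Lemma card_edge n r : #|edge n r| = 'C(n, r).
Proof. by rewrite card_sig -[n in RHS]card_ord -card_draws cardsE. Qed.

Definition blocking (n r l : nat) (D : {set edge n r}) : Prop :=
  forall L : {set 'I_n}, #|L| = l ->
    exists2 P : {set 'I_n}, (#|P| == 2) && (P \subset L) &
      [set E : edge n r | P \subset val E] \subset D.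

Lemma card_blocking_ge n r q (D : {set edge n r}) :
  blocking q.+1 D -> 'C(n, r) - turan r n q <= #|D|.
Proof.
move=> D_blocking; rewrite leq_subLR -card_edge -(cardsC D) addnC leq_add2r.
rewrite -(card_imset _ val_inj) -[n in turan r n]card_ord.
apply: card_uniform_le_turan => [_ /imsetP[E _ ->]|]; first exact/eqP/(valP E).
apply/bigmax_leqP => A /andP[_ /cliqueP clA]; rewrite leqNgt; apply/negP.
case/card_geqP=> s [s_uniq sq sA].
have card_s : #|[set:: s]| = q.+1 by rewrite cardsE (card_uniqP s_uniq).
have [P /andP[/cards2P[a [b [ab ->]]] abs] /subsetP abD] := D_blocking _ card_s.
move: abs; rewrite subUset !sub1set !inE => /andP[/sA aA /sA bA].
have /exists_inP[_ /imsetP[E ED ->] abE] := clA a b aA bA ab.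
by move: ED; rewrite inE abD // inE.
Qed.

Lemma blocking_nonrainbow n r l (I : finType) (c : 'I_n -> I) : #|I| < l ->
  blocking l [set E : edge n r | ~~ rainbow c (val E)].
Proof.
move=> Il L Ll.
have /dinjectivePn[a aL [b /andP[ba bL] cab]] : ~~ dinjectiveb c (mem L).
  apply: contraL Il => /dinjectiveP/card_in_imset cL.
  by rewrite -leqNgt -Ll -cL max_card.
exists [set a; b]; first by rewrite cards2 (eq_sym a) ba subUset !sub1set aL.
apply/subsetP => E; rewrite !inE subUset !sub1set => /andP[aE bE].
by apply: contraNN ba => /imset_injP c_inj; rewrite (c_inj b a).
Qed.

Lemma card_nonrainbow_residue n r q :
  #|[set E : edge n r | ~~ rainbow (residue q) (val E)]| =
    'C(n, r) - turan r n q.+1.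
Proof.
rewrite -card_rainbow_residue -card_edge_pred -card_edge.
rewrite -[X in _ - #|pred_of_set X|]setCK -cardsCs.
by apply: eq_card => E; rewrite !inE.
Qed.

Local Open Scope ring_scope.

Lemma in_ideal_mull (R : comNzRingType) (I : finType) (A : pred I)
  (g : I -> R) i x : A i -> in_ideal A g (x * g i).
Proof.
move=> Ai; exists (fun j => if j == i then x else 0).
rewrite (bigD1 i) //= eqxx big1 ?addr0 // => j /andP[_ /negPf ->].
by rewrite mul0r.
Qed.

Section MonomialIdeal.

Variables (R : comNzRingType) (n : nat) (I : finType) (A : pred I).
Variables (g : I -> {mpoly R[n]}) (f : I -> 'X_{1..n}).
Hypothesis gE : forall i, g i = 'X_[f i].

Lemma mpolyX_in_ideal i m : A i -> (f i <= m)%MM -> in_ideal A g 'X_[m].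
Proof.
by move=> Ai im; rewrite -(submK im) mpolyXD -gE; apply: in_ideal_mull.
Qed.

Lemma msupp_in_ideal p m : in_ideal A g p -> m \in msupp p ->
  exists2 i, A i & (f i <= m)%MM.
Proof.
move=> [c ->] mp; apply/exists_inP; apply: contraLR mp.
rewrite negb_exists_in => /forall_inP fm.
rewrite -mcoeff_eq0 linear_sum /= big1 // => i Ai.
apply/eqP; rewrite mcoeff_eq0 gE (perm_mem (msuppMX _ _)).
by apply: contra (fm i Ai) => /mapP[m' _ ->]; apply: lem_addr.
Qed.

End MonomialIdeal.

Section EdgeMonomials.

Variables (k : fieldType) (n r : nat).
Implicit Types (D : {set edge n r}) (m : 'X_{1..#|edge n r|}).

Definition edge_mnm D : 'X_{1..#|edge n r|} := mesym1 (enum_rank @: D).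

Definition edge_supp m : {set edge n r} := [set E | 0 < m (enum_rank E)]%N.

Lemma edge_mnmE D E : edge_mnm D (enum_rank E) = (E \in D).
Proof. by rewrite mnmE mem_imset //; apply: enum_rank_inj. Qed.

Lemma edge_mnmK : cancel edge_mnm edge_supp.
Proof.
by move=> D; apply/setP => E; rewrite inE edge_mnmE; case: (E \in D).
Qed.

Lemma mdeg_edge_mnm D : mdeg (edge_mnm D) = #|D|.
Proof. by rewrite mdeg_mesym1 card_imset //; apply: enum_rank_inj. Qed.

Lemma edge_mnm_le D m : (edge_mnm D <= m)%MM = (D \subset edge_supp m).
Proof.
apply/mnm_lepP/subsetP => [Dm E ED|Dm i].
  by have := Dm (enum_rank E); rewrite edge_mnmE ED inE.
rewrite -[i]enum_valK edge_mnmE; case: (boolP (_ \in D)) => [/Dm|//].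
by rewrite inE.
Qed.

Lemma card_edge_supp_le m : (#|edge_supp m| <= mdeg m)%N.
Proof.
by rewrite -mdeg_edge_mnm; apply/lemc_mdeg/lem_leo; rewrite edge_mnm_le.
Qed.

Lemma uE (P : {set 'I_n}) :
  u k r P = 'X_[edge_mnm [set E : edge n r | P \subset val E]].
Proof.
rewrite /u /y mprodXE; congr 'X_[_]; apply/mnmP => i.
rewrite -[i]enum_valK edge_mnmE inE mnm_sumE.
under eq_bigr do rewrite mnm1E (inj_eq enum_rank_inj).
rewrite big_mkcond (bigD1 (enum_val i)) //= eqxx big1 ?addn0 => [|E /negPf ->].
  by case: ifP.
by rewrite if_same.
Qed.

Lemma mpolyX_blocking_J l D :
  blocking l D -> J l ('X_[edge_mnm D] : edge_ring k n r).
Proof.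
move=> D_blocking L /D_blocking[P PL PD].
by apply: (mpolyX_in_ideal uE PL); rewrite edge_mnm_le edge_mnmK.
Qed.

Lemma msupp_J_blocking l (p : edge_ring k n r) m :
  J l p -> m \in msupp p -> blocking l (edge_supp m).
Proof.
move=> Jp mp L /Jp pL; have [P PL] := msupp_in_ideal uE pL mp.
by rewrite edge_mnm_le => Pm; exists P.
Qed.

Lemma initial_degree_J l D : blocking l D ->
    (forall D', blocking l D' -> (#|D| <= #|D'|)%N) ->
  initial_degree (@J k n l r) #|D|.
Proof.
move=> D_blocking D_min; split=> [|e p Jp p0 /dhomogP p_homog].
  exists 'X_[edge_mnm D]; split; first exact: mpolyX_blocking_J.
    by rewrite -msupp_eq0 msuppX.
  by rewrite dhomogX; apply/eqP/mdeg_edge_mnm.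
rewrite -(p_homog _ (mlead_supp p0)).
have supp_blocking := msupp_J_blocking Jp (mlead_supp p0).
exact: leq_trans (D_min _ supp_blocking) (card_edge_supp_le _).
Qed.

End EdgeMonomials.

Theorem theorem6p3 (k : fieldType) (char0 : [pchar k] =i pred0) (n l r : nat)
    (hn : (2 <= n)%N) (hl : (2 <= l)%N) (hr : (2 <= r)%N) :
  initial_degree (@J k n l r) ('C(n, r) - turan r n (l - 1))%N.
Proof.
case: l hl => [|[|q]] // _; rewrite subSS subn0 -card_nonrainbow_residue.
apply: initial_degree_J => [|D D_blocking].
  by apply: blocking_nonrainbow; rewrite card_ord.
by rewrite card_nonrainbow_residue card_blocking_ge.
Qed.
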